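(* Let $n,k$ be integers with $1<k<n$, and let $$\psi(z)=\frac{1}{2\pi i}\int_{|w|=1}w^{k-2}\exp\left\{\frac{z}{w}-\frac{1}{(n-k+1)w^{n-k+1}}-\frac{w^{k-1}}{k-1}\right\}dw .$$ Then the order of the entire function $\psi$ satisfies $\rho(\psi)=1-\frac1k$.
   Context: The circle $|w|=1$ is traversed once counterclockwise. For an entire function $f$, $\rho(f)=\limsup_{r\to\infty}\frac{\log\log M(r,f)}{\log r}$ denotes its order, where $M(r,f)=\max_{|z|=r}|f(z)|$. *)

(* Defs.v *)
(* Stdlib world: concrete reals with Coquelicot's complex numbers. *)
From Stdlib Require Import Reals.
From Coquelicot Require Import Coquelicot.

Open Scope R_scope.

Definition Cexp (z : C) : C :=
  (RtoC (exp (Re z)) * (cos (Im z), sin (Im z)))%C.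

(* The contour integral over |w| = 1, through the parametrization
   w = e^{it}, dw = i e^{it} dt, for t from 0 to 2 PI. *)
Definition unit_circle_int (f : C -> C) : C :=
  RInt (V := C_R_CompleteNormedModule)
    (fun t : R => (f (Cexp (Ci * RtoC t)) * (Ci * Cexp (Ci * RtoC t)))%C)
    0 (2 * PI).

Definition entire (f : C -> C) : Prop :=
  forall z : C, ex_derive (K := C_AbsRing) (V := C_NormedModule) f z.

(* The supremum is attained, hence is the maximum, as soon as f is continuous
   and 0 <= r. *)
Definition max_modulus (f : C -> C) (r : R) : R :=
  real (Lub_Rbar (fun m : R => exists z : C, Cmod z = r /\ m = Cmod (f z))).

(* limsup of g at +infinity: the infimum over a of the supremum over r > a.
   Coquelicot only has the limsup of sequences. *)
Definition LimSup_pinfty (g : R -> R) : Rbar :=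
  Rbar_glb (fun s : Rbar => exists a : R,
    s = Lub_Rbar (fun y : R => exists r : R, a < r /\ y = g r)).

(* ln is 0 on nonpositive reals; for nonconstant entire f this is irrelevant,
   since max_modulus f r > 1 for all large r. *)
Definition order (f : C -> C) : Rbar :=
  LimSup_pinfty (fun r : R => ln (ln (max_modulus f r)) / ln r).

(* The truncated subtractions are exact for 1 < k < n. *)
Definition psi (n k : nat) (z : C) : C :=
  (/ (2 * RtoC PI * Ci) *
   unit_circle_int (fun w : C =>
     w ^ (k - 2) *
     Cexp (z / w
           - 1 / (RtoC (INR (n - k + 1)) * w ^ (n - k + 1))
           - w ^ (k - 1) / RtoC (INR (k - 1)))))%C.

(* Main.v *)
Require Import Defs.
From Stdlib Require Import Reals Lra Lia Factorial ZArith.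
From Coquelicot Require Import Coquelicot.

Open Scope R_scope.

(* Let p = k - 1, m = n - k + 1 and alpha = -1/p, beta = -1/m.  Replacing the
   three factors exp(z/w), exp(beta w^(-m)), exp(alpha w^p) of the integrand
   by their N-th Taylor sums turns psi into the polynomials
     P_N(z) = sum z^i/i! beta^b/b! alpha^a/a!   over p - i - m b + p a = 0,
   with all indices at most N, and P_N -> psi uniformly on disks.
   Upper bound: each term may be multiplied by s^(p - i - m b + p a) = 1, so
   |P_N(z)| <= s^p exp(|z|/s + |beta| s^(-m) + |alpha| s^p); take s^(p+1) = |z|.
   Lower bound: Cauchy's estimate bounds the coefficients of P_N by the maximum
   modulus.  In the coefficient of z^(p(A+1)) the term b = 0, a = A dominates,
   so it has size about p^(-A) / (A! (p(A+1))!); the choice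
   r^p = e (p(A+1))^(p+1) then gives log M(r) >= A + 1 - log 2. *)

Local Notation CR := C_R_NormedModule.
Local Notation Csum := (@sum_n C_AbelianMonoid).

(** * Sums and integrals of complex-valued functions *)

Lemma C_ext (x y : C) : Re x = Re y -> Im x = Im y -> x = y.
Proof. destruct x, y; simpl; intros -> ->; reflexivity. Qed.

Lemma Csum_0 (f : nat -> C) : Csum f 0 = f 0%nat.
Proof. exact (sum_O f). Qed.

Lemma Csum_S (f : nat -> C) (N : nat) :
  Csum f (S N) = (Csum f N + f (S N))%C.
Proof. exact (sum_Sn f N). Qed.

Lemma Csum_ext (f g : nat -> C) (N : nat) :
  (forall j, f j = g j) -> Csum f N = Csum g N.
Proof. exact (sum_n_ext f g N). Qed.

Lemma Rsum_S (f : nat -> R) (N : nat) :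
  sum_n f (S N) = sum_n f N + f (S N).
Proof. exact (sum_Sn f N). Qed.

Lemma Rmult_sum_l (c : R) (f : nat -> R) (N : nat) :
  sum_n (fun j => c * f j) N = c * sum_n f N.
Proof. exact (sum_n_mult_l (K := R_Ring) c f N). Qed.

Lemma Cmod_sum_le (f : nat -> C) (g : nat -> R) (N : nat) :
  (forall j, Cmod (f j) <= g j) -> Cmod (Csum f N) <= sum_n g N.
Proof.
  intros H; induction N as [|N IH].
  - rewrite Csum_0, sum_O. apply H.
  - rewrite Csum_S, Rsum_S.
    eapply Rle_trans; [apply Cmod_triangle|]. specialize (H (S N)). lra.
Qed.

Lemma Cmult_sum_l (c : C) (f : nat -> C) (N : nat) :
  (c * Csum f N = Csum (fun j => c * f j) N)%C.
Proof. symmetry. exact (sum_n_mult_l (K := C_Ring) c f N). Qed.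

Lemma Cmult_sum_r (c : C) (f : nat -> C) (N : nat) :
  (Csum f N * c = Csum (fun j => f j * c) N)%C.
Proof. symmetry. exact (sum_n_mult_r (K := C_Ring) c f N). Qed.

Lemma sum_exp_le (x : R) (N : nat) :
  0 <= x -> sum_n (fun j => x ^ j / INR (fact j)) N <= exp x.
Proof. intros H. rewrite sum_n_Reals. now apply exp_ge_taylor. Qed.

(** The scalars of [C_R_NormedModule] are real, so a complex constant is moved out of the integral
    by treating real and imaginary parts separately. *)
Lemma is_RInt_Cmult (c : C) (f : R -> C) (a b : R) (l : C) :
  is_RInt (V := CR) f a b l ->
  is_RInt (V := CR) (fun t => (c * f t)%C) a b (c * l)%C.
Proof.
  intros H.
  pose proof (is_RInt_fct_extend_fst (U := R_NormedModule) (V := R_NormedModule) _ _ _ _ H) as H1.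
  pose proof (is_RInt_fct_extend_snd (U := R_NormedModule) (V := R_NormedModule) _ _ _ _ H) as H2.
  apply (is_RInt_fct_extend_pair (U := R_NormedModule) (V := R_NormedModule)).
  - apply (is_RInt_minus (V := R_NormedModule)
      (fun t => Re c * Re (f t)) (fun t => Im c * Im (f t))).
    + exact (is_RInt_scal (V := R_NormedModule) _ _ _ (Re c) _ H1).
    + exact (is_RInt_scal (V := R_NormedModule) _ _ _ (Im c) _ H2).
  - apply (is_RInt_plus (V := R_NormedModule)
      (fun t => Re c * Im (f t)) (fun t => Im c * Re (f t))).
    + exact (is_RInt_scal (V := R_NormedModule) _ _ _ (Re c) _ H2).
    + exact (is_RInt_scal (V := R_NormedModule) _ _ _ (Im c) _ H1).
Qed.

Lemma is_RInt_Csum (f : nat -> R -> C) (a b : R) (l : nat -> C) (N : nat) :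
  (forall j, is_RInt (V := CR) (f j) a b (l j)) ->
  is_RInt (V := CR) (fun t => Csum (fun j => f j t) N) a b (Csum l N).
Proof.
  intros H; induction N as [|N IH].
  - rewrite Csum_0. apply (is_RInt_ext (V := CR) (f 0%nat)); [|apply H].
    intros t _. now rewrite Csum_0.
  - rewrite Csum_S.
    apply (is_RInt_ext (V := CR)
      (fun t => plus (Csum (fun j => f j t) N : CR) (f (S N) t))).
    + intros t _. now rewrite Csum_S.
    + exact (is_RInt_plus (V := CR) _ _ _ _ _ _ IH (H (S N))).
Qed.

Lemma Cmod_is_RInt_le (f : R -> C) (g : R -> R) (a b : R) (l : C) (lg : R) :
  a <= b -> (forall t, a <= t <= b -> Cmod (f t) <= g t) ->
  is_RInt (V := CR) f a b l -> is_RInt g a b lg -> Cmod l <= lg.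
Proof.
  intros Hab Hfg Hf Hg. rewrite Cmod_norm.
  apply (norm_RInt_le (V := CR) f g a b l lg); auto.
  intros t Ht. rewrite <- Cmod_norm. auto.
Qed.

Lemma Cmod_is_RInt_le_const (f : R -> C) (a b M : R) (l : C) :
  a <= b -> (forall t, a <= t <= b -> Cmod (f t) <= M) ->
  is_RInt (V := CR) f a b l -> Cmod l <= (b - a) * M.
Proof.
  intros Hab Hf H. rewrite Cmod_norm.
  apply (norm_RInt_le_const (V := CR) f a b l M); auto.
  intros t Ht. rewrite <- Cmod_norm. auto.
Qed.

(** * Calculus of complex-valued functions of a real variable, by components *)

Definition is_derive_RC (f : R -> C) (t : R) (l : C) : Prop :=
  is_derive (fun s => Re (f s)) t (Re l) /\ is_derive (fun s => Im (f s)) t (Im l).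

Definition Ccontinuous (f : R -> C) : Prop :=
  forall t, continuous (fun s => Re (f s)) t /\ continuous (fun s => Im (f s)) t.

Lemma is_derive_RC_continuous (f df : R -> C) :
  (forall t, is_derive_RC f t (df t)) -> Ccontinuous f.
Proof.
  intros H t. destruct (H t) as [H1 H2].
  split; apply (ex_derive_continuous (V := R_NormedModule)); eexists; eassumption.
Qed.

Lemma Ccontinuous_mult (f g : R -> C) :
  Ccontinuous f -> Ccontinuous g -> Ccontinuous (fun t => (f t * g t)%C).
Proof.
  intros Hf Hg t. destruct (Hf t) as [F1 F2], (Hg t) as [G1 G2]. split.
  - apply (continuous_minus (V := R_NormedModule)
      (fun s => Re (f s) * Re (g s)) (fun s => Im (f s) * Im (g s)));
      now apply (continuous_mult (K := R_AbsRing)).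
  - apply (continuous_plus (V := R_NormedModule)
      (fun s => Re (f s) * Im (g s)) (fun s => Im (f s) * Re (g s)));
      now apply (continuous_mult (K := R_AbsRing)).
Qed.

Lemma Ccontinuous_minus (f g : R -> C) :
  Ccontinuous f -> Ccontinuous g -> Ccontinuous (fun t => (f t - g t)%C).
Proof.
  intros Hf Hg t. destruct (Hf t) as [F1 F2], (Hg t) as [G1 G2].
  split; now apply (continuous_minus (V := R_NormedModule)).
Qed.

Lemma Ccontinuous_const (c : C) : Ccontinuous (fun _ => c).
Proof. intros t; split; apply continuous_const. Qed.

Lemma Ccontinuous_Cexp (f : R -> C) :
  Ccontinuous f -> Ccontinuous (fun t => Cexp (f t)).
Proof.
  intros Hf. apply (Ccontinuous_mult (fun t => RtoC (exp (Re (f t))))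
    (fun t => (cos (Im (f t)), sin (Im (f t))))); intros t;
    destruct (Hf t) as [H1 H2]; split; simpl.
  - now apply continuous_exp_comp.
  - apply continuous_const.
  - now apply continuous_cos_comp.
  - now apply continuous_sin_comp.
Qed.

Lemma Ccontinuous_ex_RInt (f : R -> C) (a b : R) :
  Ccontinuous f -> is_RInt (V := CR) f a b (RInt (V := C_R_CompleteNormedModule) f a b).
Proof.
  intros Hf. apply (RInt_correct (V := C_R_CompleteNormedModule)).
  destruct (ex_RInt_continuous (V := R_CompleteNormedModule) (fun s => Re (f s)) a b)
    as [l1 H1]; [intros t _; apply Hf|].
  destruct (ex_RInt_continuous (V := R_CompleteNormedModule) (fun s => Im (f s)) a b)
    as [l2 H2]; [intros t _; apply Hf|].
  exists (l1, l2).
  now apply (is_RInt_fct_extend_pair (U := R_NormedModule) (V := R_NormedModule)).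
Qed.

Lemma is_RInt_derive_RC (f df : R -> C) (a b : R) :
  (forall t, is_derive_RC f t (df t)) -> Ccontinuous df ->
  is_RInt (V := CR) df a b (f b - f a)%C.
Proof.
  intros H Hc. apply (is_RInt_fct_extend_pair (U := R_NormedModule) (V := R_NormedModule)).
  - apply (is_RInt_derive (V := R_CompleteNormedModule) (fun s => Re (f s))
      (fun s => Re (df s))); intros t _; [apply H|apply Hc].
  - apply (is_RInt_derive (V := R_CompleteNormedModule) (fun s => Im (f s))
      (fun s => Im (df s))); intros t _; [apply H|apply Hc].
Qed.

(** * The complex exponential and its Taylor remainder *)

Lemma Cexp_plus (x y : C) : Cexp (x + y) = (Cexp x * Cexp y)%C.
Proof.
  destruct x as [a b], y as [c d]. unfold Cexp; simpl.
  rewrite exp_plus, cos_plus, sin_plus.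
  apply C_ext; simpl; ring.
Qed.

Lemma pow_exp (x : R) (n : nat) : exp x ^ n = exp (INR n * x).
Proof.
  induction n as [|n IH].
  - simpl. now rewrite Rmult_0_l, exp_0.
  - rewrite S_INR, Rmult_plus_distr_r, exp_plus, <- IH, Rmult_1_l. simpl. ring.
Qed.

Lemma Cmod_cos_sin (x : R) : Cmod (cos x, sin x) = 1.
Proof.
  unfold Cmod; simpl. transitivity (sqrt 1); [f_equal|apply sqrt_1].
  generalize (sin2_cos2 x). unfold Rsqr. lra.
Qed.

Lemma Cmod_Cexp (u : C) : Cmod (Cexp u) = exp (Re u).
Proof.
  unfold Cexp. rewrite Cmod_mult, Cmod_R, Cmod_cos_sin, Rabs_pos_eq; [ring|].
  apply Rlt_le, exp_pos.
Qed.

Lemma exp_le_compat (x y : R) : x <= y -> exp x <= exp y.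
Proof.
  intros [H| ->]; [now apply Rlt_le, exp_increasing|apply Rle_refl].
Qed.

Lemma Cmod_Cexp_le (u : C) : Cmod (Cexp u) <= exp (Cmod u).
Proof.
  rewrite Cmod_Cexp. apply exp_le_compat.
  eapply Rle_trans; [apply Rle_abs|apply re_le_Cmod].
Qed.

Definition exp_sum (N : nat) (u : C) : C :=
  Csum (fun j => (RtoC (/ INR (fact j)) * u ^ j)%C) N.

Lemma Cmod_exp_sum_le (N : nat) (u : C) : Cmod (exp_sum N u) <= exp (Cmod u).
Proof.
  eapply Rle_trans; [|apply (sum_exp_le (Cmod u) N), Cmod_ge_0].
  apply Cmod_sum_le. intros j. rewrite Cmod_mult, Cmod_R, Cmod_pow.
  rewrite Rabs_pos_eq.
  - right. unfold Rdiv. ring.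
  - apply Rlt_le, Rinv_0_lt_compat, INR_fact_lt_0.
Qed.

(** Restricting to the ray [s * u] makes the Taylor remainder at [u] a question about one real
    variable in [[0, 1]]. *)
Lemma is_derive_RC_Cexp (u : C) (t : R) :
  is_derive_RC (fun s => Cexp (RtoC s * u)) t (u * Cexp (RtoC t * u))%C.
Proof.
  destruct u as [x y]. split; unfold Cexp, Re, Im; simpl; auto_derive; auto; unfold Rminus; ring.
Qed.


Lemma is_derive_RC_plus (f g : R -> C) (t : R) (df dg : C) :
  is_derive_RC f t df -> is_derive_RC g t dg ->
  is_derive_RC (fun s => f s + g s)%C t (df + dg)%C.
Proof.
  intros [F1 F2] [G1 G2]. split.
  - exact (is_derive_plus (V := R_NormedModule) _ _ _ _ _ F1 G1).
  - exact (is_derive_plus (V := R_NormedModule) _ _ _ _ _ F2 G2).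
Qed.

Lemma is_derive_RC_opp (f : R -> C) (t : R) (df : C) :
  is_derive_RC f t df -> is_derive_RC (fun s => - f s)%C t (- df)%C.
Proof.
  intros [F1 F2]. split.
  - exact (is_derive_opp (V := R_NormedModule) _ _ _ F1).
  - exact (is_derive_opp (V := R_NormedModule) _ _ _ F2).
Qed.

Lemma is_derive_RC_ext (f g : R -> C) (t : R) (df : C) :
  (forall s, f s = g s) -> is_derive_RC f t df -> is_derive_RC g t df.
Proof.
  intros H [F1 F2]. split; eapply is_derive_ext; try eassumption;
    intros s; simpl; now rewrite H.
Qed.

Lemma is_derive_RC_scal (h : R -> R) (c : C) (t dh : R) :
  is_derive h t dh -> is_derive_RC (fun s => RtoC (h s) * c)%C t (RtoC dh * c)%C.
Proof.
  intros D. split.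
  - rewrite re_scal_l. apply (is_derive_ext (fun s => Re c * h s)).
    { intros s. rewrite re_scal_l. apply Rmult_comm. }
    rewrite Rmult_comm. exact (is_derive_scal h t (Re c) dh D).
  - rewrite im_scal_l. apply (is_derive_ext (fun s => Im c * h s)).
    { intros s. rewrite im_scal_l. apply Rmult_comm. }
    rewrite Rmult_comm. exact (is_derive_scal h t (Im c) dh D).
Qed.

Lemma is_derive_RC_pow (n : nat) (u : C) (t : R) :
  is_derive_RC (fun s => (RtoC (/ INR (fact (S n))) * (RtoC s * u) ^ S n)%C) t
    (u * (RtoC (/ INR (fact n)) * (RtoC t * u) ^ n))%C.
Proof.
  assert (Hf : / INR (fact n) = INR (S n) * / INR (fact (S n))).
  { rewrite fact_simpl, mult_INR. field. split; [apply INR_fact_neq_0|].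
    now apply not_0_INR. }
  rewrite Hf. set (c := / INR (fact (S n))).
  apply is_derive_RC_ext with (f := fun s => (RtoC (c * s ^ S n) * u ^ S n)%C).
  { intros s. now rewrite Cpow_mult_l, RtoC_mult, RtoC_pow, Cmult_assoc. }
  replace (u * (RtoC (INR (S n) * c) * (RtoC t * u) ^ n))%C
    with (RtoC (c * (INR (S n) * t ^ n)) * u ^ S n)%C.
  2:{ rewrite Cpow_mult_l, Cpow_S, !RtoC_mult, RtoC_pow. ring. }
  assert (D : is_derive (fun s : R => c * s ^ S n) t (c * (INR (S n) * t ^ n))).
  { auto_derive; auto. rewrite S_INR; destruct n; simpl; ring. }
  now apply is_derive_RC_scal.
Qed.

Lemma is_derive_RC_exp_sum (N : nat) (u : C) (t : R) :
  is_derive_RC (fun s => exp_sum (S N) (RtoC s * u)) t (u * exp_sum N (RtoC t * u))%C.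
Proof.
  assert (H0 : forall c : C, is_derive_RC (fun _ => c) t (RtoC 0)).
  { intros c. split; apply @is_derive_const. }
  unfold exp_sum. induction N as [|N IH].
  - rewrite Csum_0. apply is_derive_RC_ext with (f := fun s =>
      (RtoC (/ INR (fact 0)) * (RtoC s * u) ^ 0 +
       RtoC (/ INR (fact 1)) * (RtoC s * u) ^ 1)%C).
    { intros s. now rewrite Csum_S, Csum_0. }
    rewrite <- (Cplus_0_l (u * _)). apply is_derive_RC_plus.
    + exact (H0 (RtoC (/ INR (fact 0)) * 1)%C).
    + apply is_derive_RC_pow.
  - rewrite Csum_S, Cmult_plus_distr_l.
    apply is_derive_RC_ext with (f := fun s =>
      (Csum (fun j => RtoC (/ INR (fact j)) * (RtoC s * u) ^ j)%C (S N) +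
       RtoC (/ INR (fact (S (S N)))) * (RtoC s * u) ^ S (S N))%C).
    { intros s. now rewrite (Csum_S _ (S N)). }
    apply is_derive_RC_plus; [exact IH|apply is_derive_RC_pow].
Qed.

Lemma Ccontinuous_exp_sum (N : nat) (u : C) :
  Ccontinuous (fun t => exp_sum N (RtoC t * u)).
Proof.
  destruct N as [|N].
  - apply (is_derive_RC_continuous _ (fun _ => RtoC 0)). intros t.
    apply is_derive_RC_ext with (f := fun _ => (RtoC (/ INR (fact 0)) * 1)%C).
    + intros s. unfold exp_sum. now rewrite Csum_0.
    + split; apply @is_derive_const.
  - eapply is_derive_RC_continuous. intros t; apply is_derive_RC_exp_sum.
Qed.

Lemma is_RInt_pow (n : nat) (c : R) :
  is_RInt (fun t => c * t ^ n) 0 1 (c / INR (S n)).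
Proof.
  assert (Hn : INR (S n) <> 0) by now apply not_0_INR.
  replace (c / INR (S n)) with (minus (c / INR (S n) * 1 ^ S n) (c / INR (S n) * 0 ^ S n)).
  2:{ rewrite pow1, pow_i by lia. unfold minus, plus, opp; simpl plus. simpl. field.
      exact Hn. }
  apply (is_RInt_derive (V := R_CompleteNormedModule) (fun t => c / INR (S n) * t ^ S n)).
  - intros t _. auto_derive; auto.
    change (match n with 0%nat => 1 | S _ => INR n + 1 end) with (INR (S n)).
    simpl pred. field. exact Hn.
  - intros t _. apply (ex_derive_continuous (V := R_NormedModule)).
    auto_derive; auto.
Qed.

Lemma Cexp_0 : Cexp 0 = 1%C.
Proof. unfold Cexp; simpl. rewrite exp_0, cos_0, sin_0. apply C_ext; simpl; ring. Qed.

(** Induction on [N]: along [t * u] the derivative of the remainder of index [S N] is [u] times the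
    remainder of index [N], and both [Cexp] and the partial sums equal 1 at 0. Integrating the
    previous bound over [[0, 1]] gives the next one. *)
Lemma Cexp_exp_sum (N : nat) (u : C) :
  Cmod (Cexp u - exp_sum N u) <=
  Cmod u ^ S N / INR (fact (S N)) * exp (Cmod u).
Proof.
  assert (Hexp : forall t v, 0 <= t <= 1 -> exp (Cmod (RtoC t * v)) <= exp (Cmod v)).
  { intros t v Ht. rewrite Cmod_mult, Cmod_R, Rabs_pos_eq by lra.
    apply exp_le_compat. generalize (Cmod_ge_0 v); intros Hv. nra. }
  revert u; induction N as [|N IH]; intros u.
  - unfold exp_sum. rewrite Csum_0.
    replace (Cexp u - _)%C with (Cexp (RtoC 1 * u) - Cexp (RtoC 0 * u))%C.
    2:{ rewrite Cmult_0_l, Cmult_1_l, Cexp_0. simpl. rewrite Rinv_1. ring. }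
    apply (Cmod_is_RInt_le (fun t => u * Cexp (RtoC t * u))%C
      (* The factor [t ^ 0] puts the constant majorant in the form required by [is_RInt_pow]. *)
      (fun t => Cmod u * exp (Cmod u) * t ^ 0) 0 1); [lra| | |].
    + intros t Ht. rewrite Cmod_mult, pow_O, Rmult_1_r.
      apply Rmult_le_compat_l; [apply Cmod_ge_0|].
      eapply Rle_trans; [apply Cmod_Cexp_le|now apply Hexp].
    + apply (is_RInt_derive_RC (fun t => Cexp (RtoC t * u))).
      * intros t. apply is_derive_RC_Cexp.
      * apply Ccontinuous_mult; [apply Ccontinuous_const|].
        eapply is_derive_RC_continuous. intros t; apply is_derive_RC_Cexp.
    + replace (_ / _ * _) with (Cmod u * exp (Cmod u) / INR 1) by (simpl; field).
      apply is_RInt_pow.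
  - set (f := fun t => (Cexp (RtoC t * u) - exp_sum (S N) (RtoC t * u))%C).
    assert (Df : forall t, is_derive_RC f t
      (u * (Cexp (RtoC t * u) - exp_sum N (RtoC t * u)))%C).
    { intros t. replace (u * _)%C with
        (u * Cexp (RtoC t * u) + - (u * exp_sum N (RtoC t * u)))%C by ring.
      apply is_derive_RC_plus; [apply is_derive_RC_Cexp|].
      apply is_derive_RC_opp, is_derive_RC_exp_sum. }
    replace (Cexp u - _)%C with (f 1 - f 0)%C.
    2:{ unfold f. rewrite Cmult_0_l, Cmult_1_l, Cexp_0.
        replace (exp_sum (S N) 0) with (RtoC 1); [ring|].
        unfold exp_sum. clear. induction N as [|N IH]; rewrite Csum_S.
        - rewrite Csum_0. simpl. rewrite Rinv_1. ring.
        - rewrite <- IH. simpl. ring. }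
    (* The induction hypothesis at [t * u] supplies [t ^ S N], whose integral [1 / (N + 2)]
       completes the factorial; the exponential is frozen at its value for [t = 1]. *)
    apply (Cmod_is_RInt_le (fun t => u * (Cexp (RtoC t * u) - exp_sum N (RtoC t * u)))%C
      (fun t => Cmod u ^ S (S N) / INR (fact (S N)) * exp (Cmod u) * t ^ S N) 0 1);
      [lra| | |].
    + intros t Ht. rewrite Cmod_mult.
      eapply Rle_trans.
      { apply Rmult_le_compat_l; [apply Cmod_ge_0|].
        eapply Rle_trans; [apply IH|].
        apply Rmult_le_compat_l; [|now apply Hexp].
        apply Rdiv_le_0_compat; [apply pow_le, Cmod_ge_0|apply INR_fact_lt_0]. }
      right. rewrite Cmod_mult, Cmod_R, Rabs_pos_eq by lra.
      rewrite Rpow_mult_distr. simpl. unfold Rdiv. ring.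
    + apply (is_RInt_derive_RC f); [exact Df|].
      apply Ccontinuous_mult; [apply Ccontinuous_const|].
      apply Ccontinuous_minus; [|apply Ccontinuous_exp_sum].
      eapply is_derive_RC_continuous. intros t; apply is_derive_RC_Cexp.
    + replace (Cmod u ^ S (S N) / INR (fact (S (S N))) * exp (Cmod u))
        with (Cmod u ^ S (S N) / INR (fact (S N)) * exp (Cmod u) / INR (S (S N))).
      * apply is_RInt_pow.
      * rewrite (fact_simpl (S N)), mult_INR. field.
        split; [apply INR_fact_neq_0|now apply not_0_INR].
Qed.

(** * Integrals of trigonometric polynomials *)

Definition eit (x : R) : C := (cos x, sin x).

Lemma eit_plus (x y : R) : eit (x + y) = (eit x * eit y)%C.
Proof. unfold eit. rewrite cos_plus, sin_plus. apply C_ext; simpl; ring. Qed.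

Lemma eit_0 : eit 0 = 1%C.
Proof. unfold eit. now rewrite cos_0, sin_0. Qed.

Lemma Cmod_eit (x : R) : Cmod (eit x) = 1.
Proof. apply Cmod_cos_sin. Qed.

Lemma eit_neq_0 (x : R) : eit x <> 0%C.
Proof. apply Cmod_gt_0. rewrite Cmod_eit. lra. Qed.

Lemma eit_pow (x : R) (n : nat) : (eit x ^ n)%C = eit (INR n * x).
Proof.
  induction n as [|n IH].
  - simpl. now rewrite Rmult_0_l, eit_0.
  - rewrite Cpow_S, IH, <- eit_plus, S_INR. f_equal. ring.
Qed.

Lemma eit_inv (x : R) : (/ eit x)%C = eit (- x).
Proof.
  rewrite <- (Cmult_1_l (/ eit x)), <- eit_0.
  replace 0 with (- x + x) by ring. rewrite eit_plus.
  field. apply eit_neq_0.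
Qed.

Lemma Cexp_Ci (t : R) : Cexp (Ci * RtoC t) = eit t.
Proof.
  unfold Cexp, eit; simpl.
  replace (0 * t - 1 * 0) with 0 by ring.
  replace (0 * 0 + 1 * t) with t by ring.
  rewrite exp_0. apply C_ext; simpl; ring.
Qed.

Lemma Ccontinuous_eit (a : R) : Ccontinuous (fun t => eit (a * t)).
Proof.
  intros t; split; apply (ex_derive_continuous (V := R_NormedModule));
    unfold eit; simpl; auto_derive; auto.
Qed.

(** The mean of [w^l] over the unit circle, from which the iterated means below start. *)
Definition delta0 (l : Z) : C := if Z.eq_dec l 0 then RtoC 1 else RtoC 0.

Lemma sin_Zmult_2PI (l : Z) : sin (IZR l * (2 * PI)) = 0.
Proof.
  apply sin_eq_0_1. exists (2 * l)%Z. rewrite mult_IZR. simpl; ring.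
Qed.

Lemma cos_Zmult_2PI (l : Z) : cos (IZR l * (2 * PI)) = 1.
Proof.
  replace (IZR l * (2 * PI)) with (2 * (IZR l * PI)) by ring.
  rewrite cos_2a_sin, (sin_eq_0_1 (IZR l * PI)) by now exists l. ring.
Qed.

Lemma is_RInt_eit (l : Z) :
  is_RInt (V := CR) (fun t => eit (IZR l * t)) 0 (2 * PI) (RtoC (2 * PI) * delta0 l)%C.
Proof.
  unfold delta0. destruct (Z.eq_dec l 0) as [->|Hl].
  - rewrite Cmult_1_r. apply (is_RInt_ext (V := CR) (fun _ => RtoC 1)).
    { intros t _. now rewrite Rmult_0_l, eit_0. }
    replace (RtoC (2 * PI)) with (scal (2 * PI - 0) (RtoC 1 : CR)).
    { exact (is_RInt_const (V := CR) 0 (2 * PI) (RtoC 1)). }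
    etransitivity; [exact (scal_R_Cmult (2 * PI - 0) (RtoC 1))|].
    now rewrite Cmult_1_r, Rminus_0_r.
  - assert (Hl' : IZR l <> 0) by now apply not_0_IZR.
    rewrite Cmult_0_r.
    (* This is the antiderivative [e^(ilt) / (il)] in components. *)
    set (f := fun t => (sin (IZR l * t) / IZR l, - cos (IZR l * t) / IZR l) : C).
    replace (RtoC 0) with (f (2 * PI)%R - f 0%R)%C.
    2:{ unfold f. rewrite sin_Zmult_2PI, cos_Zmult_2PI, Rmult_0_r, sin_0, cos_0.
        apply C_ext; simpl; lra. }
    apply is_RInt_derive_RC; [|apply Ccontinuous_eit].
    intros t. unfold f, eit. split; simpl; auto_derive; auto; field; exact Hl'.
Qed.

(** Multiplying [G] by a trigonometric polynomial replaces its moments by a finite combination of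
    shifted moments. Asking for the moments at every [l] lets the rule be iterated. *)
Lemma is_RInt_trig_mult (x : nat -> C) (lam : nat -> Z) (N : nat) (G : R -> C)
  (a b : R) (I : Z -> C) :
  (forall l, is_RInt (V := CR) (fun t => eit (IZR l * t) * G t)%C a b (I l)) ->
  forall l, is_RInt (V := CR)
    (fun t => eit (IZR l * t) * (Csum (fun j => x j * eit (IZR (lam j) * t)) N * G t))%C
    a b (Csum (fun j => x j * I (l + lam j)%Z)%C N).
Proof.
  intros H l.
  apply (is_RInt_ext (V := CR)
    (fun t => Csum (fun j => x j * (eit (IZR (l + lam j) * t) * G t))%C N)).
  - intros t _. rewrite Cmult_sum_r, Cmult_sum_l. apply Csum_ext. intros j.
    rewrite plus_IZR, Rmult_plus_distr_r, eit_plus. ring.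
  - apply (is_RInt_Csum (fun j t => x j * (eit (IZR (l + lam j) * t) * G t))%C).
    intros j. apply is_RInt_Cmult, H.
Qed.

Definition expcoef (c : C) (j : nat) : C := (RtoC (/ INR (fact j)) * c ^ j)%C.

Lemma Cmod_expcoef (c : C) (j : nat) : Cmod (expcoef c j) = Cmod c ^ j / INR (fact j).
Proof.
  unfold expcoef. rewrite Cmod_mult, Cmod_R, Cmod_pow, Rabs_pos_eq.
  - unfold Rdiv; ring.
  - apply Rlt_le, Rinv_0_lt_compat, INR_fact_lt_0.
Qed.

Lemma exp_sum_eit (N : nat) (c : C) (kap : Z) (t : R) :
  exp_sum N (c * eit (IZR kap * t)) =
  Csum (fun j => expcoef c j * eit (IZR (Z.of_nat j * kap) * t))%C N.
Proof.
  apply Csum_ext. intros j. unfold expcoef.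
  rewrite Cpow_mult_l, eit_pow, mult_IZR, <- INR_IZR_INZ, Rmult_assoc. ring.
Qed.

(* With [w = e^(it)]: if [I l] is the mean of [w^l G] over the circle, then
   [exp_conv N c kap I l] is the mean of [w^l exp_sum N (c w^kap) G]. *)
Definition exp_conv (N : nat) (c : C) (kap : Z) (I : Z -> C) (l : Z) : C :=
  Csum (fun j => expcoef c j * I (l + Z.of_nat j * kap)%Z)%C N.

Lemma is_RInt_exp_conv (N : nat) (c : C) (kap : Z) (G : R -> C) (I : Z -> C) :
  (forall l, is_RInt (V := CR) (fun t => eit (IZR l * t) * G t)%C
     0 (2 * PI) (RtoC (2 * PI) * I l)%C) ->
  forall l, is_RInt (V := CR)
    (fun t => eit (IZR l * t) * (exp_sum N (c * eit (IZR kap * t)) * G t))%C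
    0 (2 * PI) (RtoC (2 * PI) * exp_conv N c kap I l)%C.
Proof.
  intros H l. unfold exp_conv. rewrite Cmult_sum_l.
  replace (Csum _ N) with
    (Csum (fun j => expcoef c j * (RtoC (2 * PI) * I (l + Z.of_nat j * kap)%Z))%C N)
    by (apply Csum_ext; intros j; ring).
  apply (is_RInt_ext (V := CR) (fun t => eit (IZR l * t) *
     (Csum (fun j => expcoef c j * eit (IZR (Z.of_nat j * kap) * t)) N * G t))%C).
  - intros t _. now rewrite exp_sum_eit.
  - exact (is_RInt_trig_mult (expcoef c) (fun j => (Z.of_nat j * kap)%Z) N G _ _
      (fun l => RtoC (2 * PI) * I l)%C H l).
Qed.

Lemma powerRZ_of_nat_mul (s : R) (j : nat) (k : Z) :
  s <> 0 -> powerRZ s (Z.of_nat j * k) = powerRZ s k ^ j.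
Proof.
  intros Hs. induction j as [|j IH]; [reflexivity|].
  rewrite Nat2Z.inj_succ, Z.mul_succ_l, powerRZ_add, IH by exact Hs. simpl; ring.
Qed.

(** A bound [B s^l] is what integration over the circle of radius [s] would give, so this replaces a
    change of contour. The shift by [j * kap] costs a factor [(s^kap)^j], and the sum over [j] is a
    partial sum of an exponential. *)
Lemma Cmod_exp_conv_le (N : nat) (c : C) (kap : Z) (I : Z -> C) (s B : R) (l : Z) :
  0 < s -> 0 <= B -> (forall l, Cmod (I l) <= B * powerRZ s l) ->
  Cmod (exp_conv N c kap I l) <= (B * exp (Cmod c * powerRZ s kap)) * powerRZ s l.
Proof.
  intros Hs HB H. unfold exp_conv.
  assert (Hk : 0 < powerRZ s kap) by now apply powerRZ_lt.
  assert (Hl : 0 < powerRZ s l) by now apply powerRZ_lt.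
  eapply Rle_trans.
  - apply Cmod_sum_le with (g := fun j =>
      B * powerRZ s l * ((Cmod c * powerRZ s kap) ^ j / INR (fact j))).
    intros j. rewrite Cmod_mult, Cmod_expcoef.
    eapply Rle_trans.
    + apply Rmult_le_compat_l; [|apply H].
      apply Rdiv_le_0_compat; [apply pow_le, Cmod_ge_0|apply INR_fact_lt_0].
    + right.
      rewrite powerRZ_add, Rpow_mult_distr, powerRZ_of_nat_mul by lra. unfold Rdiv; ring.
  - rewrite Rmult_sum_l.
    replace (B * exp _ * powerRZ s l) with
      (B * powerRZ s l * exp (Cmod c * powerRZ s kap)) by ring.
    apply Rmult_le_compat_l; [nra|].
    apply sum_exp_le. generalize (Cmod_ge_0 c); nra.
Qed.

(** Only [l = 0] matters, where [s^l = 1]; hence [s] stays free until it is tied to the modulus of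
    [z]. *)
Lemma Cmod_delta0_le (s : R) (l : Z) : 0 < s -> Cmod (delta0 l) <= 1 * powerRZ s l.
Proof.
  intros Hs. unfold delta0. destruct (Z.eq_dec l 0) as [->|_].
  - rewrite Cmod_1. simpl. lra.
  - rewrite Cmod_0. generalize (powerRZ_lt s l Hs). lra.
Qed.

(** * Polynomial approximation of psi *)

(** The factor [w^(k-2)] and the [w] of [dw = i w dt] combine to [w^p] with [p = k - 1], and [i]
    cancels against [2 pi i]. Powers of [w] are written as [eit] at integer frequencies so that
    [is_RInt_exp_conv] applies. *)
Definition psi_integrand (p m : nat) (z : C) (t : R) : C :=
  (eit (IZR (Z.of_nat p) * t) * (Cexp (z * eit (IZR (-1) * t)) *
   (Cexp (RtoC (- / INR m) * eit (IZR (- Z.of_nat m) * t)) *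
    Cexp (RtoC (- / INR p) * eit (IZR (Z.of_nat p) * t)))))%C.

Lemma Ccontinuous_psi_integrand (p m : nat) (z : C) :
  Ccontinuous (psi_integrand p m z).
Proof.
  assert (H : forall c a, Ccontinuous (fun t => Cexp (c * eit (a * t)))).
  { intros c a. apply Ccontinuous_Cexp, Ccontinuous_mult.
    - apply Ccontinuous_const.
    - apply Ccontinuous_eit. }
  apply Ccontinuous_mult; [apply Ccontinuous_eit|].
  apply Ccontinuous_mult; [apply H|].
  apply Ccontinuous_mult; apply H.
Qed.

Lemma psi_RInt (n k : nat) (z : C) :
  (1 < k)%nat -> (k < n)%nat ->
  psi n k z = (RtoC (/ (2 * PI)) *
    RInt (V := C_R_CompleteNormedModule) (psi_integrand (k - 1) (n - k + 1) z) 0 (2 * PI))%C.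
Proof.
  intros hk hkn. unfold psi, unit_circle_int.
  set (p := (k - 1)%nat). set (m := (n - k + 1)%nat).
  assert (Hp : INR p <> 0) by (apply not_0_INR; unfold p; lia).
  assert (Hm : INR m <> 0) by (apply not_0_INR; unfold m; lia).
  assert (HPI : 2 * PI <> 0) by (generalize PI_RGT_0; lra).
  rewrite (RInt_ext (V := C_R_CompleteNormedModule) _
    (fun t => (Ci * psi_integrand p m z t)%C)).
  - rewrite (is_RInt_unique (V := C_R_CompleteNormedModule) _ _ _ _
      (is_RInt_Cmult Ci _ _ _ _ (Ccontinuous_ex_RInt _ 0 (2 * PI)
        (Ccontinuous_psi_integrand p m z)))).
    rewrite <- RtoC_mult, RtoC_inv by exact HPI.
    field. split; [|exact Ci_nz].
    intros H. apply RtoC_inj in H. contradiction.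
  - intros t _. rewrite Cexp_Ci. unfold psi_integrand.
    unfold Cminus. rewrite !Cexp_plus.
    rewrite opp_IZR, <- !INR_IZR_INZ.
    replace (-1 * t) with (- t) by ring.
    replace (- INR m * t) with (- (INR m * t)) by ring.
    rewrite <- !eit_inv, <- !eit_pow.
    assert (Hw := eit_neq_0 t).
    assert (Hwm := Cpow_nz _ m Hw).
    assert (Hmc : RtoC (INR m) <> 0%C) by (intros H; now apply RtoC_inj in H).
    assert (Hpc : RtoC (INR p) <> 0%C) by (intros H; now apply RtoC_inj in H).
    rewrite !RtoC_opp, !RtoC_inv by assumption.
    replace (- (1 / (RtoC (INR m) * eit t ^ m)))%C
      with (- / RtoC (INR m) * / eit t ^ m)%C by (field; auto).
    replace (- (eit t ^ p / RtoC (INR p)))%C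
      with (- / RtoC (INR p) * eit t ^ p)%C by (field; auto).
    assert (Hpk : (eit t ^ p = eit t * eit t ^ (k - 2))%C).
    { rewrite <- Cpow_S. f_equal. unfold p; lia. }
    rewrite Hpk. unfold Cdiv.
    (* The equality is restated with carrier [C], the type on which [ring] works. *)
    match goal with |- @eq _ ?a ?b => change (@eq C a b) end. ring.
Qed.

(** The convolution in [z] is outermost: [psi_poly] is thus visibly a polynomial in [z], and the
    coefficient of [z^i] is [1 / i!] times the inner double convolution at [p - i]. *)
Definition psi_poly (p m N : nat) (z : C) : C :=
  exp_conv N z (-1) (exp_conv N (RtoC (- / INR m)) (- Z.of_nat m)
    (exp_conv N (RtoC (- / INR p)) (Z.of_nat p) delta0)) (Z.of_nat p).

(** The trailing factor [1] is the innermost function, with moments [delta0]; each of the three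
    Taylor sums is then brought in by one use of [is_RInt_exp_conv]. *)
Lemma psi_poly_RInt (p m N : nat) (z : C) :
  is_RInt (V := CR)
    (fun t => eit (IZR (Z.of_nat p) * t) * (exp_sum N (z * eit (IZR (-1) * t)) *
      (exp_sum N (RtoC (- / INR m) * eit (IZR (- Z.of_nat m) * t)) *
       (exp_sum N (RtoC (- / INR p) * eit (IZR (Z.of_nat p) * t)) * 1))))%C
    0 (2 * PI) (RtoC (2 * PI) * psi_poly p m N z)%C.
Proof.
  set (b := RtoC (- / INR m)). set (c := RtoC (- / INR p)).
  set (G := fun t => (exp_sum N (c * eit (IZR (Z.of_nat p) * t)) * 1)%C).
  apply (is_RInt_exp_conv N z (-1)
    (fun t => exp_sum N (b * eit (IZR (- Z.of_nat m) * t)) * G t)%C).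
  apply (is_RInt_exp_conv N b (- Z.of_nat m) G).
  apply (is_RInt_exp_conv N c (Z.of_nat p) (fun _ => RtoC 1)).
  intros l. apply (is_RInt_ext (V := CR) (fun t => eit (IZR l * t))); [|apply is_RInt_eit].
  intros t _. symmetry. exact (Cmult_1_r _).
Qed.

Lemma le_of_forall_eps (x y : R) : (forall eps, 0 < eps -> x <= y + eps) -> x <= y.
Proof.
  intros H. destruct (Rle_lt_dec x y) as [h|h]; [exact h|].
  specialize (H ((x - y) / 2)). lra.
Qed.

(** Telescoping: the factors are exchanged one at a time, and each exchange costs at most
    [e * K ^ 2]. *)
Lemma Cmod_mult3_minus (A B D A' B' D' : C) (K e : R) :
  Cmod A <= K -> Cmod B <= K -> Cmod D <= K -> Cmod A' <= K -> Cmod B' <= K ->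
  Cmod (A - A') <= e -> Cmod (B - B') <= e -> Cmod (D - D') <= e ->
  Cmod (A * (B * D) - A' * (B' * D')) <= 3 * (e * K ^ 2).
Proof.
  intros.
  replace (A * (B * D) - A' * (B' * D'))%C with
    ((A - A') * (B * D) + (A' * ((B - B') * D) + A' * (B' * (D - D'))))%C by ring.
  assert (prod : forall x y z a b c, 0 <= x <= a -> 0 <= y <= b -> 0 <= z <= c ->
    x * (y * z) <= a * (b * c)).
  { intros x y z a b c Hx Hy Hz. apply Rmult_le_compat; try tauto.
    - now apply Rmult_le_pos.
    - apply Rmult_le_compat; tauto. }
  assert (E1 : Cmod ((A - A') * (B * D)) <= e * (K * K)).
  { rewrite !Cmod_mult. apply prod; split; auto using Cmod_ge_0. }
  assert (E2 : Cmod (A' * ((B - B') * D)) <= K * (e * K)).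
  { rewrite !Cmod_mult. apply prod; split; auto using Cmod_ge_0. }
  assert (E3 : Cmod (A' * (B' * (D - D'))) <= K * (K * e)).
  { rewrite !Cmod_mult. apply prod; split; auto using Cmod_ge_0. }
  eapply Rle_trans; [apply Cmod_triangle|].
  eapply Rle_trans; [apply Rplus_le_compat_l, Cmod_triangle|]. nra.
Qed.

Lemma Cexp_exp_sum_uniform (N : nat) (u : C) (R0 : R) :
  Cmod u <= R0 ->
  Cmod (Cexp u) <= exp R0 /\ Cmod (exp_sum N u) <= exp R0 /\
  Cmod (Cexp u - exp_sum N u) <= R0 ^ S N / INR (fact (S N)) * exp R0.
Proof.
  intros Hu. assert (He := exp_le_compat _ _ Hu). assert (H0 := Cmod_ge_0 u).
  repeat split.
  - eapply Rle_trans; [apply Cmod_Cexp_le|exact He].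
  - eapply Rle_trans; [apply Cmod_exp_sum_le|exact He].
  - eapply Rle_trans; [apply Cexp_exp_sum|].
    assert (Hf := INR_fact_lt_0 (S N)).
    apply Rmult_le_compat; [|apply Rlt_le, exp_pos| |exact He].
    + apply Rdiv_le_0_compat; [now apply pow_le|exact Hf].
    + apply Rmult_le_compat_r; [apply Rlt_le, Rinv_0_lt_compat, Hf|].
      now apply pow_incr.
Qed.

Lemma Cmod_Rinv_opp (p : nat) : (0 < p)%nat -> Cmod (RtoC (- / INR p)) = / INR p.
Proof.
  intros Hp. rewrite Cmod_R, Rabs_Ropp, Rabs_pos_eq; [reflexivity|].
  apply Rlt_le, Rinv_0_lt_compat. now apply lt_0_INR.
Qed.

Lemma Rinv_INR_le_1 (p : nat) : (0 < p)%nat -> / INR p <= 1.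
Proof.
  intros Hp. rewrite <- Rinv_1. apply Rinv_le_contravar; [lra|].
  now apply (le_INR 1).
Qed.

(** On the unit circle all three exponents have modulus at most [r], since [1/m] and [1/p] are at
    most 1. So [Cmod_mult3_minus] applies with [K = exp r] and with the Taylor remainder as [e]. *)
Lemma psi_poly_error (n k N : nat) (z : C) (r : R) :
  (1 < k)%nat -> (k < n)%nat -> 1 <= r -> Cmod z <= r ->
  Cmod (psi n k z - psi_poly (k - 1) (n - k + 1) N z) <=
  3 * (r ^ S N / INR (fact (S N)) * exp r * exp r ^ 2).
Proof.
  intros hk hkn Hr Hz. rewrite psi_RInt by assumption.
  set (p := (k - 1)%nat). set (m := (n - k + 1)%nat).
  assert (Hp : (0 < p)%nat) by (unfold p; lia).
  assert (Hm : (0 < m)%nat) by (unfold m; lia).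
  assert (HPI := PI_RGT_0).
  set (err := 3 * _).
  assert (HF := Ccontinuous_ex_RInt _ 0 (2 * PI) (Ccontinuous_psi_integrand p m z)).
  assert (HP := psi_poly_RInt p m N z).
  assert (HD := is_RInt_minus (V := CR) _ _ _ _ _ _ HF HP).
  apply (Cmod_is_RInt_le_const _ _ _ err) in HD; [|lra|].
  - set (I := RInt _ _ _) in *.
    assert (H2 : RtoC (2 * PI) <> 0%C) by (intros H; apply RtoC_inj in H; lra).
    replace (RtoC (/ (2 * PI)) * I - psi_poly p m N z)%C
      with (RtoC (/ (2 * PI)) * (I - RtoC (2 * PI) * psi_poly p m N z))%C.
    2:{ rewrite RtoC_inv by lra. field. exact H2. }
    rewrite Cmod_mult, Cmod_R, Rabs_pos_eq
      by (apply Rlt_le, Rinv_0_lt_compat; lra).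
    apply Rmult_le_reg_l with (2 * PI); [lra|].
    rewrite <- Rmult_assoc, Rinv_r, Rmult_1_l by lra.
    eapply Rle_trans; [exact HD|]. lra.
  - intros t _. unfold psi_integrand.
    set (a := (z * _)%C). set (b := (RtoC (- / INR m) * _)%C).
    set (c := (RtoC (- / INR p) * _)%C).
    change (Cmod (eit (IZR (Z.of_nat p) * t) * (Cexp a * (Cexp b * Cexp c)) -
      eit (IZR (Z.of_nat p) * t) * (exp_sum N a * (exp_sum N b * (exp_sum N c * 1)))) <= err).
    replace (_ - _)%C with (eit (IZR (Z.of_nat p) * t) *
      (Cexp a * (Cexp b * Cexp c) - exp_sum N a * (exp_sum N b * exp_sum N c)))%C by ring.
    rewrite Cmod_mult, Cmod_eit, Rmult_1_l.
    assert (Ha : Cmod a <= r).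
    { unfold a. now rewrite Cmod_mult, Cmod_eit, Rmult_1_r. }
    assert (Hb : Cmod b <= r).
    { unfold b. rewrite Cmod_mult, Cmod_eit, Rmult_1_r, Cmod_Rinv_opp by exact Hm.
      apply Rle_trans with 1; [now apply Rinv_INR_le_1|exact Hr]. }
    assert (Hc : Cmod c <= r).
    { unfold c. rewrite Cmod_mult, Cmod_eit, Rmult_1_r, Cmod_Rinv_opp by exact Hp.
      apply Rle_trans with 1; [now apply Rinv_INR_le_1|exact Hr]. }
    destruct (Cexp_exp_sum_uniform N a r Ha) as (A1 & A2 & A3).
    destruct (Cexp_exp_sum_uniform N b r Hb) as (B1 & B2 & B3).
    destruct (Cexp_exp_sum_uniform N c r Hc) as (C1 & C2 & C3).
    now apply Cmod_mult3_minus.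
Qed.

(** The index [N0] is uniform in [z], because Cauchy's estimate needs one polynomial on the whole
    circle. *)
Lemma psi_poly_cv (n k : nat) (r eps : R) :
  (1 < k)%nat -> (k < n)%nat -> 1 <= r -> 0 < eps ->
  exists N0, forall N, (N0 <= N)%nat -> forall z, Cmod z <= r ->
  Cmod (psi n k z - psi_poly (k - 1) (n - k + 1) N z) <= eps.
Proof.
  intros hk hkn Hr Heps.
  assert (HK : 0 < 3 * (exp r * exp r ^ 2)).
  { assert (He := exp_pos r). apply Rmult_lt_0_compat; [lra|].
    apply Rmult_lt_0_compat; [exact He|]. now apply pow_lt. }
  destruct (cv_speed_pow_fact r (eps / (3 * (exp r * exp r ^ 2)))) as [N0 HN0].
  { now apply Rdiv_lt_0_compat. }
  exists N0. intros N HN z Hz.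
  eapply Rle_trans; [now apply psi_poly_error with (r := r)|].
  specialize (HN0 (S N)). unfold R_dist in HN0.
  rewrite Rminus_0_r in HN0.
  assert (H := Rle_lt_trans _ _ _ (Rle_abs _) (HN0 ltac:(lia))).
  apply Rmult_lt_compat_r with (r := 3 * (exp r * exp r ^ 2)) in H; [|exact HK].
  replace (eps / _ * _) with eps in H by (field; generalize (exp_pos r); lra).
  lra.
Qed.

Lemma psi_poly_bound (p m N : nat) (z : C) (s : R) :
  (0 < p)%nat -> (0 < m)%nat -> 1 <= s -> Cmod z = s ^ S p ->
  Cmod (psi_poly p m N z) <= exp (4 * s ^ p).
Proof.
  intros Hp Hm Hs Hz. unfold psi_poly.
  assert (Hs0 : 0 < s) by lra.
  assert (He : forall x, 0 <= exp x) by (intros; apply Rlt_le, exp_pos).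
  eapply Rle_trans.
  { apply Cmod_exp_conv_le with (s := s); [exact Hs0| |].
    2:{ intros l. apply Cmod_exp_conv_le; [exact Hs0| |].
        2:{ intros l'. apply Cmod_exp_conv_le with (B := 1); [exact Hs0|lra|].
            intros; now apply Cmod_delta0_le. }
        rewrite Rmult_1_l; apply He. }
    rewrite Rmult_1_l; apply Rmult_le_pos; apply He. }
  rewrite !Cmod_Rinv_opp, Hz by assumption.
  rewrite <- pow_powerRZ, powerRZ_neg', <- pow_powerRZ.
  assert (Hsp : 1 <= s ^ p) by now apply pow_R1_Rle.
  assert (Hsm : 1 <= s ^ m) by now apply pow_R1_Rle.
  replace (s ^ S p * powerRZ s (-1)) with (s ^ p) by (simpl; field; lra).
  rewrite Rmult_1_l, <- !exp_plus.
  (* The prefactor [s ^ p] is absorbed into [exp (s ^ p)]. The constant 4 counts this term and the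
     three exponents, each of which is at most [s ^ p]. *)
  apply Rle_trans with (exp (/ INR p * s ^ p + / INR m * / s ^ m + s ^ p) * exp (s ^ p)).
  { apply Rmult_le_compat_l; [apply He|].
    generalize (exp_ineq1_le (s ^ p)). lra. }
  rewrite <- exp_plus. apply exp_le_compat.
  assert (H1 := Rinv_INR_le_1 p Hp). assert (H2 := Rinv_INR_le_1 m Hm).
  assert (H3 : / s ^ m <= 1).
  { rewrite <- Rinv_1. apply Rinv_le_contravar; lra. }
  assert (0 < / INR m) by now apply Rinv_0_lt_compat, lt_0_INR.
  assert (0 < / s ^ m) by (apply Rinv_0_lt_compat; lra).
  nra.
Qed.

(** The bound on [psi_poly] does not depend on [N], so it survives the limit. *)
Lemma psi_bound (n k : nat) (z : C) (s : R) :
  (1 < k)%nat -> (k < n)%nat -> 1 <= s -> Cmod z = s ^ k ->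
  Cmod (psi n k z) <= exp (4 * s ^ (k - 1)).
Proof.
  intros hk hkn Hs Hz. apply le_of_forall_eps. intros eps Heps.
  destruct (psi_poly_cv n k (s ^ k) eps hk hkn) as [N HN]; auto.
  { now apply pow_R1_Rle. }
  specialize (HN N (Nat.le_refl N) z ltac:(lra)).
  assert (H := psi_poly_bound (k - 1) (n - k + 1) N z s ltac:(lia) ltac:(lia) Hs).
  replace (S (k - 1)) with k in H by lia. specialize (H Hz).
  replace (psi n k z) with (psi_poly (k - 1) (n - k + 1) N z +
    (psi n k z - psi_poly (k - 1) (n - k + 1) N z))%C by ring.
  eapply Rle_trans; [apply Cmod_triangle|]. lra.
Qed.

(** * Sums with few nonzero terms and Cauchy's estimate *)

Lemma Csum_eq_0 (f : nat -> C) (N : nat) :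
  (forall j, (j <= N)%nat -> f j = 0%C) -> Csum f N = RtoC 0.
Proof.
  induction N as [|N IH]; intros H.
  - rewrite Csum_0. now apply H.
  - rewrite Csum_S, IH, H by auto. apply Cplus_0_l.
Qed.

Lemma Csum_single (f : nat -> C) (j N : nat) :
  (j <= N)%nat -> (forall i, i <> j -> f i = 0%C) -> Csum f N = f j.
Proof.
  intros Hj H. induction N as [|N IH].
  - replace j with 0%nat by lia. apply Csum_0.
  - rewrite Csum_S. destruct (Nat.eq_dec j (S N)) as [->|Hne].
    + rewrite Csum_eq_0; [apply Cplus_0_l|]. intros i Hi. apply H. lia.
    + rewrite IH, (H (S N)) by lia. apply Cplus_0_r.
Qed.

(** Meant for sums against [delta0], where [l + i * p = 0] has at most one solution [i]. *)
Lemma Cmod_sum_at_most_one (f : nat -> C) (E : R) (N : nat) :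
  0 <= E -> (forall i, Cmod (f i) <= E) ->
  (forall i j, f i <> 0%C -> f j <> 0%C -> i = j) -> Cmod (Csum f N) <= E.
Proof.
  intros HE Hf H. induction N as [|N IH].
  - rewrite Csum_0. apply Hf.
  - rewrite Csum_S. destruct (Ceq_dec (f (S N)) 0) as [h|h].
    + now rewrite h, Cplus_0_r.
    + rewrite Csum_eq_0, Cplus_0_l; [apply Hf|].
      intros j Hj. destruct (Ceq_dec (f j) 0) as [h'|h']; [exact h'|].
      specialize (H _ _ h h'). lia.
Qed.

(** The term [g 0] is kept on the right so that the bound can be a full partial sum of the
    exponential series. *)
Lemma Cmod_sum_minus_head (f : nat -> C) (g : nat -> R) (N : nat) :
  0 <= g 0%nat -> (forall j, (0 < j)%nat -> Cmod (f j) <= g j) ->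
  Cmod (Csum f N - f 0%nat) <= sum_n g N.
Proof.
  intros H0 H. induction N as [|N IH].
  - rewrite Csum_0, sum_O. replace (_ - _)%C with (RtoC 0) by ring. now rewrite Cmod_0.
  - rewrite Csum_S, Rsum_S.
    replace (_ + _ - _)%C with (Csum f N - f 0%nat + f (S N))%C by ring.
    eapply Rle_trans; [apply Cmod_triangle|].
    specialize (H (S N) ltac:(lia)). lra.
Qed.

Lemma expcoef_mult (c d : C) (j : nat) : expcoef (c * d) j = (expcoef c j * d ^ j)%C.
Proof. unfold expcoef. rewrite Cpow_mult_l. ring. Qed.

(** At [z = r e^(it)] the convolution is a trigonometric polynomial with coefficients [x i];
    integrating it against [e^(-ijt)] isolates [x j]. *)
Lemma exp_conv_cauchy_estimate (N j : nat) (I : Z -> C) (l : Z) (r B : R) :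
  0 <= r -> (j <= N)%nat ->
  (forall z, Cmod z = r -> Cmod (exp_conv N z (-1) I l) <= B) ->
  r ^ j / INR (fact j) * Cmod (I (l - Z.of_nat j)%Z) <= B.
Proof.
  intros Hr Hj HB. assert (HPI := PI_RGT_0).
  set (x := fun i => (expcoef (RtoC r) i * I (l + Z.of_nat i * -1)%Z)%C).
  assert (H : is_RInt (V := CR)
    (fun t => eit (IZR (- Z.of_nat j) * t) *
      (Csum (fun i => x i * eit (IZR (Z.of_nat i) * t)) N * 1))%C 0 (2 * PI)
    (Csum (fun i => x i * (RtoC (2 * PI) * delta0 (- Z.of_nat j + Z.of_nat i)))%C N)).
  { apply (is_RInt_trig_mult x Z.of_nat N (fun _ => RtoC 1) 0 (2 * PI)
      (fun l => RtoC (2 * PI) * delta0 l)%C).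
    intros l'. apply (is_RInt_ext (V := CR) (fun t => eit (IZR l' * t)));
      [|apply is_RInt_eit].
    intros t _. now rewrite Cmult_1_r. }
  rewrite (Csum_single _ j) in H; [|exact Hj|].
  2:{ intros i Hi. unfold delta0. destruct (Z.eq_dec _ _); [lia|ring]. }
  apply (Cmod_is_RInt_le_const _ _ _ B) in H; [|lra|].
  - revert H. unfold delta0, x. destruct (Z.eq_dec _ _) as [_|]; [|lia].
    rewrite !Cmod_mult, Cmod_expcoef, !Cmod_R, Rabs_R1, !Rabs_pos_eq by lra.
    replace (l + Z.of_nat j * -1)%Z with (l - Z.of_nat j)%Z by lia.
    intros H. apply Rmult_le_reg_l with (2 * PI); lra.
  - intros t _. rewrite Cmod_mult, Cmod_eit, Rmult_1_l, Cmult_1_r.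
    replace (Csum _ N) with (exp_conv N (RtoC r * eit t) (-1) I l).
    + apply HB. rewrite Cmod_mult, Cmod_eit, Cmod_R, Rabs_pos_eq; lra.
    + apply Csum_ext. intros i. unfold x.
      rewrite expcoef_mult, eit_pow, INR_IZR_INZ. ring.
Qed.

(** * Lower bound for the coefficients *)

Lemma expcoef_decreasing (c : C) (i j : nat) :
  Cmod c <= 1 -> (i <= j)%nat -> Cmod (expcoef c j) <= Cmod (expcoef c i).
Proof.
  intros Hc Hij. induction Hij as [|j Hij IH]; [apply Rle_refl|].
  eapply Rle_trans; [|exact IH]. rewrite !Cmod_expcoef.
  assert (Hf := INR_fact_lt_0 j). assert (H0 := Cmod_ge_0 c).
  assert (Hp := pow_le _ j H0).
  apply Rmult_le_compat.
  - now apply pow_le.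
  - apply Rlt_le, Rinv_0_lt_compat, INR_fact_lt_0.
  - simpl. nra.
  - apply Rinv_le_contravar; [exact Hf|]. apply le_INR.
    rewrite fact_simpl. nia.
Qed.

Lemma expcoef_S_le (c : C) (A : nat) :
  Cmod c <= 1 -> Cmod (expcoef c (S A)) <= Cmod (expcoef c A) / INR (S A).
Proof.
  intros Hc. rewrite !Cmod_expcoef, fact_simpl, mult_INR.
  assert (Hf := INR_fact_lt_0 A). assert (H0 := Cmod_ge_0 c).
  assert (Hp := pow_le _ A H0).
  assert (HA : 0 < INR (S A)) by (apply lt_0_INR; lia).
  replace (Cmod c ^ S A / _) with (Cmod c * (Cmod c ^ A / INR (fact A) / INR (S A)))
    by (simpl pow; field; split; apply Rgt_not_eq; assumption).
  rewrite <- (Rmult_1_l (Cmod c ^ A / _ / _)) at 2.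
  apply Rmult_le_compat_r; [|exact Hc].
  repeat (apply Rdiv_le_0_compat; [|assumption]). exact Hp.
Qed.

Lemma exp_conv_delta0_eq (N A p : nat) (c : C) :
  (0 < p)%nat -> (A <= N)%nat ->
  exp_conv N c (Z.of_nat p) delta0 (- Z.of_nat (p * A)) = expcoef c A.
Proof.
  intros Hp HA. unfold exp_conv. rewrite (Csum_single _ A); [|exact HA|].
  - unfold delta0. destruct (Z.eq_dec _ _); [ring|lia].
  - intros i Hi. unfold delta0. destruct (Z.eq_dec _ _); [|ring].
    exfalso. nia.
Qed.

(** The only possible nonzero term has [l + i * p = 0], which forces [i > A], and the moduli of the
    exponential coefficients decrease. *)
Lemma exp_conv_delta0_le (N A p : nat) (c : C) (l : Z) :
  (0 < p)%nat -> Cmod c <= 1 -> (l < - Z.of_nat (p * A))%Z ->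
  Cmod (exp_conv N c (Z.of_nat p) delta0 l) <= Cmod (expcoef c (S A)).
Proof.
  intros Hp Hc Hl. apply Cmod_sum_at_most_one.
  - apply Cmod_ge_0.
  - intros i. unfold delta0. destruct (Z.eq_dec _ _) as [e|_].
    + rewrite Cmult_1_r. apply expcoef_decreasing; [exact Hc|]. nia.
    + rewrite Cmult_0_r, Cmod_0. apply Cmod_ge_0.
  - intros i j. unfold delta0. destruct (Z.eq_dec _ _) as [e|_].
    + destruct (Z.eq_dec _ _) as [e'|_]; [nia|].
      intros _ H. now rewrite Cmult_0_r in H.
    + intros H. now rewrite Cmult_0_r in H.
Qed.

(* The terms of the outer sum of index [> 0] carry a coefficient of [exp] of
   index at least [S A], hence smaller than the leading one by a factor [S A]. *)
Lemma psi_poly_coef_lower (N A p m : nat) :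
  (0 < p)%nat -> (0 < m)%nat -> (5 <= A)%nat -> (A <= N)%nat ->
  (/ INR p) ^ A / INR (fact A) / 2 <=
  Cmod (exp_conv N (RtoC (- / INR m)) (- Z.of_nat m)
    (exp_conv N (RtoC (- / INR p)) (Z.of_nat p) delta0) (- Z.of_nat (p * A))).
Proof.
  intros Hp Hm HA HN.
  set (b := RtoC (- / INR m)). set (c := RtoC (- / INR p)).
  assert (Hb : Cmod b <= 1).
  { unfold b. rewrite Cmod_Rinv_opp by exact Hm. now apply Rinv_INR_le_1. }
  assert (Hc : Cmod c <= 1).
  { unfold c. rewrite Cmod_Rinv_opp by exact Hp. now apply Rinv_INR_le_1. }
  rewrite <- (Cmod_Rinv_opp p Hp). fold c. rewrite <- Cmod_expcoef.
  set (a := Cmod (expcoef c A)).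
  assert (Ha : 0 <= a) by apply Cmod_ge_0.
  unfold exp_conv at 1. set (f := fun j : nat => _).
  assert (Hf0 : f 0%nat = expcoef c A).
  { unfold f. replace (- Z.of_nat (p * A) + Z.of_nat 0 * - Z.of_nat m)%Z
      with (- Z.of_nat (p * A))%Z by lia.
    rewrite exp_conv_delta0_eq by assumption. unfold expcoef at 1. simpl.
    rewrite Rinv_1. ring. }
  assert (HS : 0 < INR (S A)) by (apply lt_0_INR; lia).
  assert (HE : 0 <= a / INR (S A)) by now apply Rdiv_le_0_compat.
  assert (H : Cmod (Csum f N - f 0%nat) <=
    sum_n (fun j => a / INR (S A) * (Cmod b ^ j / INR (fact j))) N).
  { apply Cmod_sum_minus_head.
    - apply Rmult_le_pos; [exact HE|]. simpl. lra.
    - intros j Hj. unfold f. rewrite Cmod_mult, Cmod_expcoef, Rmult_comm.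
      apply Rmult_le_compat_r.
      { apply Rdiv_le_0_compat; [apply pow_le, Cmod_ge_0|apply INR_fact_lt_0]. }
      eapply Rle_trans; [|now apply expcoef_S_le].
      apply exp_conv_delta0_le; [exact Hp|exact Hc|nia]. }
  rewrite Rmult_sum_l, Hf0 in H.
  assert (Hexp : sum_n (fun j => Cmod b ^ j / INR (fact j)) N <= 3).
  { eapply Rle_trans; [apply sum_exp_le, Cmod_ge_0|].
    eapply Rle_trans; [now apply exp_le_compat, Hb|]. apply exp_le_3. }
  (* From [5 <= A], and since the exponential sum is at most 3, the other terms lose at most
     [3 / 6], half of the leading term. *)
  assert (H6 : a / INR (S A) <= a / 6).
  { apply Rmult_le_compat_l; [exact Ha|]. apply Rinv_le_contravar; [lra|].
    apply (le_INR 5) in HA. rewrite S_INR.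
    replace (INR 5) with 5 in HA by (simpl; ring). lra. }
  assert (Hd : Cmod (Csum f N - expcoef c A) <= a / 2).
  { eapply Rle_trans; [exact H|].
    apply Rle_trans with (a / INR (S A) * 3); [now apply Rmult_le_compat_l|lra]. }
  assert (Ht : a <= Cmod (Csum f N) + Cmod (Csum f N - expcoef c A)).
  { unfold a. replace (expcoef c A) with (Csum f N + - (Csum f N - expcoef c A))%C at 1 by ring.
    eapply Rle_trans; [apply Cmod_triangle|]. rewrite Cmod_opp. lra. }
  change (a / 2 <= Cmod (Csum f N)). lra.
Qed.

(** The coefficient of [z^j] involves the inner convolution at [p - j], which is [- p * A] for
    [j = p * (A + 1)], the place treated by [psi_poly_coef_lower]. The polynomial is bounded by
    [M + eps] on the circle, and [eps] is arbitrary. *)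
Lemma psi_coef_bound (n k A : nat) (r M : R) :
  (1 < k)%nat -> (k < n)%nat -> (5 <= A)%nat -> 1 <= r ->
  (forall z, Cmod z = r -> Cmod (psi n k z) <= M) ->
  r ^ ((k - 1) * S A) / INR (fact ((k - 1) * S A)) *
    ((/ INR (k - 1)) ^ A / INR (fact A) / 2) <= M.
Proof.
  intros hk hkn HA Hr HM. apply le_of_forall_eps. intros eps Heps.
  destruct (psi_poly_cv n k r eps hk hkn Hr Heps) as [N0 HN0].
  set (p := (k - 1)%nat) in *. set (m := (n - k + 1)%nat) in *.
  assert (Hp : (0 < p)%nat) by (unfold p; lia).
  assert (Hm : (0 < m)%nat) by (unfold m; lia).
  (* This [N] is past the threshold of uniform approximation and large enough for both indices [j]
     and [A] to occur. *)
  set (j := (p * S A)%nat). set (N := (N0 + j)%nat).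
  assert (HAN : (A <= N)%nat) by (unfold N, j; nia).
  eapply Rle_trans; [|apply (exp_conv_cauchy_estimate N j
    (exp_conv N (RtoC (- / INR m)) (- Z.of_nat m)
      (exp_conv N (RtoC (- / INR p)) (Z.of_nat p) delta0)) (Z.of_nat p) r)].
  - apply Rmult_le_compat_l.
    { apply Rdiv_le_0_compat; [apply pow_le; lra|apply INR_fact_lt_0]. }
    replace (Z.of_nat p - Z.of_nat j)%Z with (- Z.of_nat (p * A))%Z by (unfold j; lia).
    now apply psi_poly_coef_lower.
  - lra.
  - unfold N; lia.
  - intros z Hz. change (Cmod (psi_poly p m N z) <= M + eps).
    specialize (HN0 N ltac:(unfold N; lia) z (Req_le _ _ Hz)). specialize (HM z Hz).
    replace (psi_poly p m N z) with (psi n k z + - (psi n k z - psi_poly p m N z))%C by ring.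
    eapply Rle_trans; [apply Cmod_triangle|]. rewrite Cmod_opp. lra.
Qed.

Lemma fact_le_pow (n : nat) : INR (fact n) <= INR n ^ n.
Proof.
  (* The base [n] is held fixed while the exponent grows. *)
  assert (H : forall i, (i <= n)%nat -> INR (fact i) <= INR n ^ i).
  { induction i as [|i IH]; intros Hi; [simpl; lra|].
    rewrite fact_simpl, mult_INR. simpl pow.
    apply Rmult_le_compat; [apply pos_INR|apply pos_INR|now apply le_INR|apply IH; lia]. }
  now apply H.
Qed.

(** With [j = p * (A + 1)], the choice of [r] gives [r^j = e^(A+1) j^(k(A+1))], and
    [k(A+1) = j + (A+1)]. The power [j^j] beats [j!] and [j^(A+1)] beats [p^A A!], so that
    [e^(A+1) / 2] remains. *)
Lemma psi_growth (n k A : nat) (r M : R) :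
  (1 < k)%nat -> (k < n)%nat -> (5 <= A)%nat -> 1 <= r ->
  r ^ (k - 1) = exp 1 * INR ((k - 1) * S A) ^ k ->
  (forall z, Cmod z = r -> Cmod (psi n k z) <= M) -> exp (INR (S A)) / 2 <= M.
Proof.
  intros hk hkn HA Hr Hrk HM.
  eapply Rle_trans; [|now apply (psi_coef_bound n k A r M)].
  set (p := (k - 1)%nat) in *.
  assert (Hp : (0 < p)%nat) by (unfold p; lia).
  set (j := (p * S A)%nat) in *.
  assert (Hj : 0 < INR j) by (apply lt_0_INR; unfold j; lia).
  assert (HpR : 0 < INR p) by now apply lt_0_INR.
  assert (E : r ^ j = exp (INR (S A)) * (INR j ^ j * INR j ^ S A)).
  { unfold j at 1. rewrite pow_mult, Hrk, Rpow_mult_distr. f_equal.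
    - now rewrite pow_exp, Rmult_1_r.
    - rewrite <- pow_mult, <- pow_add. f_equal. unfold j, p. nia. }
  rewrite E.
  assert (H1 : 1 <= INR j ^ j / INR (fact j)).
  { apply Rmult_le_reg_r with (INR (fact j)); [apply INR_fact_lt_0|].
    unfold Rdiv. rewrite Rmult_assoc, Rinv_l by apply INR_fact_neq_0.
    rewrite Rmult_1_l, Rmult_1_r. apply fact_le_pow. }
  assert (H2 : 1 <= INR j ^ S A * ((/ INR p) ^ A / INR (fact A))).
  { assert (Hpa : 0 < INR p ^ A) by now apply pow_lt.
    assert (Hf := INR_fact_lt_0 A).
    apply Rmult_le_reg_r with (INR p ^ A * INR (fact A)); [now apply Rmult_lt_0_compat|].
    replace (INR j ^ S A * _ * _) with (INR j ^ S A).
    2:{ rewrite pow_inv. field. split; apply Rgt_not_eq; assumption. }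
    rewrite Rmult_1_l. unfold j. rewrite mult_INR, Rpow_mult_distr.
    apply Rmult_le_compat; [lra|lra| |].
    - apply Rle_pow; [|lia]. apply (le_INR 1). lia.
    - eapply Rle_trans; [|apply fact_le_pow]. apply le_INR, fact_le. lia. }
  assert (He := exp_pos (INR (S A))).
  replace (exp _ * _ / _ * _) with (exp (INR (S A)) / 2 * ((INR j ^ j / INR (fact j)) *
    (INR j ^ S A * ((/ INR p) ^ A / INR (fact A))))) by (unfold Rdiv; ring).
  rewrite <- (Rmult_1_r (exp (INR (S A)) / 2)) at 1.
  apply Rmult_le_compat_l; [lra|].
  rewrite <- (Rmult_1_l 1). apply Rmult_le_compat; lra.
Qed.

(** * The order of psi *)

(** The a priori bound [B] excludes the value plus infinity and the point [RtoC r] excludes minus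
    infinity; [real] therefore returns the actual supremum. *)
Lemma max_modulus_le (f : C -> C) (r B : R) :
  0 <= r -> (forall z, Cmod z = r -> Cmod (f z) <= B) ->
  max_modulus f r <= B /\ forall z, Cmod z = r -> Cmod (f z) <= max_modulus f r.
Proof.
  intros Hr HB. unfold max_modulus.
  set (E := fun m : R => _).
  destruct (Lub_Rbar_correct E) as [Hub Hlub].
  assert (HleB : Rbar_le (Lub_Rbar E) B).
  { apply Hlub. intros x (z & Hz & ->). now apply HB. }
  assert (Hin : E (Cmod (f (RtoC r)))).
  { exists (RtoC r). split; [|reflexivity]. now rewrite Cmod_R, Rabs_pos_eq. }
  assert (Hge := Hub _ Hin).
  destruct (Lub_Rbar E) as [x| |]; simpl in *; try tauto.
  split; [exact HleB|]. intros z Hz. apply (Hub (Cmod (f z))). now exists z.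
Qed.

Lemma LimSup_pinfty_eq (g : R -> R) (l : R) :
  (forall eps, 0 < eps -> exists a, forall r, a < r -> g r <= l + eps) ->
  (forall eps a, 0 < eps -> exists r, a < r /\ l - eps <= g r) ->
  LimSup_pinfty g = Finite l.
Proof.
  intros Hup Hlo. apply Rbar_is_glb_unique. split.
  - intros s [a ->].
    set (E := fun y : R => _).
    destruct (Lub_Rbar_correct E) as [Hub _].
    (* Any value of [g] beyond [a] keeps the supremum from being minus infinity. *)
    destruct (Hlo 1 a Rlt_0_1) as (r0 & Hr0 & _).
    assert (H0 := Hub (g r0) (ex_intro _ r0 (conj Hr0 eq_refl))).
    destruct (Lub_Rbar E) as [x| |]; simpl in *; try tauto.
    apply le_of_forall_eps. intros eps Heps.
    destruct (Hlo eps a Heps) as (r & Hr & Hg).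
    assert (H := Hub (g r) (ex_intro _ r (conj Hr eq_refl))). simpl in H. lra.
  - intros b Hb.
    assert (H : forall eps, 0 < eps -> Rbar_le b (l + eps)).
    { intros eps Heps. destruct (Hup eps Heps) as [a Ha].
      eapply Rbar_le_trans; [apply Hb; exists a; reflexivity|].
      apply Lub_Rbar_correct. intros y (r & Hr & ->). now apply Ha. }
    destruct b as [x| |]; simpl in *; try tauto.
    + apply le_of_forall_eps. exact H.
    + exact (H 1 Rlt_0_1).
Qed.

(* The junk value [ln x = 0] for [x <= 0] is harmless here. *)
Lemma ln_le_of_ge_1 (x y : R) : x <= y -> 1 <= y -> ln x <= ln y.
Proof.
  intros Hxy Hy. destruct (Rlt_dec 0 x) as [Hx|Hx].
  - now apply ln_le.
  - replace (ln x) with 0.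
    + rewrite <- ln_1. apply ln_le; lra.
    + unfold ln. now destruct (Rlt_dec 0 x).
Qed.

(** * Complex differentiability of [psi] *)

Lemma is_derive_C_of_quadratic (f : C -> C) (z l : C) (K : R) :
  0 < K ->
  (forall h, Cmod h <= 1 -> Cmod (f (z + h) - f z - h * l)%C <= K * Cmod h ^ 2) ->
  is_derive (K := C_AbsRing) (V := C_NormedModule) f z l.
Proof.
  intros HK H. split; [apply is_linear_scal_l|].
  intros x Hx.
  (* Differentiability is formulated at every limit [x] of the neighbourhood filter of [z], and such
     a limit is [z] itself. *)
  assert (Hzx : z = x) by exact (is_filter_lim_locally_unique (K := C_AbsRing)
    (V := AbsRing_NormedModule C_AbsRing) z x Hx).
  subst x. intros eps.
  (* Below [eps / K] the quadratic error is at most [eps] times the increment; the cap 1 keeps the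
     increment in the range of the hypothesis. *)
  assert (Hd : 0 < Rmin 1 (eps / K)).
  { apply Rmin_pos; [lra|]. apply Rdiv_lt_0_compat; [apply eps|exact HK]. }
  exists (mkposreal _ Hd). intros y. change C in y. intros Hy.
  change (Cmod (y - z) < Rmin 1 (eps / K)) in Hy.
  change (Cmod ((f y - f z) - (y - z) * l) <= eps * Cmod (y - z))%C.
  specialize (H (y - z)%C).
  assert (E : (z + (y - z))%C = y) by ring. rewrite E in H.
  assert (H1 := Rmin_l 1 (eps / K)). assert (H2 := Rmin_r 1 (eps / K)).
  eapply Rle_trans; [apply H; lra|].
  replace (K * Cmod (y - z) ^ 2) with (K * Cmod (y - z) * Cmod (y - z)) by ring.
  apply Rmult_le_compat_r; [apply Cmod_ge_0|].
  apply Rle_trans with (K * (eps / K)).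
  - apply Rmult_le_compat_l; lra.
  - right. field. lra.
Qed.

(** Differentiation under the integral sign: with [e = 1/w], the increment minus its linear part has
    integrand [F z t * (Cexp (h * e) - 1 - h * e)], which is quadratic in [h] by the Taylor estimate
    of index 1. *)
Lemma psi_entire (n k : nat) : (1 < k)%nat -> (k < n)%nat -> entire (psi n k).
Proof.
  intros hk hkn z. assert (HPI := PI_RGT_0).
  set (p := (k - 1)%nat). set (m := (n - k + 1)%nat).
  assert (Hp : (0 < p)%nat) by (unfold p; lia).
  assert (Hm : (0 < m)%nat) by (unfold m; lia).
  set (F := psi_integrand p m).
  assert (HF : forall u, is_RInt (V := CR) (F u) 0 (2 * PI)
    (RInt (V := C_R_CompleteNormedModule) (F u) 0 (2 * PI))).
  { intros u. apply Ccontinuous_ex_RInt, Ccontinuous_psi_integrand. }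
  set (D := fun t => (eit (IZR (-1) * t) * F z t)%C).
  assert (HD : is_RInt (V := CR) D 0 (2 * PI)
    (RInt (V := C_R_CompleteNormedModule) D 0 (2 * PI))).
  { apply Ccontinuous_ex_RInt, Ccontinuous_mult;
      [apply Ccontinuous_eit|apply Ccontinuous_psi_integrand]. }
  exists (RtoC (/ (2 * PI)) * RInt (V := C_R_CompleteNormedModule) D 0 (2 * PI))%C.
  (* The factors bound, in this order, the three exponentials of the integrand and the Taylor
     remainder for [Cmod h <= 1]. *)
  apply is_derive_C_of_quadratic with (K := exp (Cmod z) * (exp 1 * exp 1) * exp 1).
  { repeat apply Rmult_lt_0_compat; apply exp_pos. }
  intros h Hh. rewrite !psi_RInt by assumption. fold p m. fold F.
  assert (H := is_RInt_minus (V := CR) _ _ _ _ _ _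
    (is_RInt_minus (V := CR) _ _ _ _ _ _ (HF (z + h)%C) (HF z)) (is_RInt_Cmult h _ _ _ _ HD)).
  set (I1 := RInt (V := C_R_CompleteNormedModule) (F (z + h)%C) _ _) in *.
  set (I2 := RInt (V := C_R_CompleteNormedModule) (F z) _ _) in *.
  set (I3 := RInt (V := C_R_CompleteNormedModule) D _ _) in *.
  apply (Cmod_is_RInt_le_const _ _ _
    (exp (Cmod z) * (exp 1 * exp 1) * exp 1 * Cmod h ^ 2)) in H; [|lra|].
  - replace (_ - _ - _)%C with (RtoC (/ (2 * PI)) * (I1 - I2 - h * I3))%C by ring.
    rewrite Cmod_mult, Cmod_R, Rabs_pos_eq
      by (apply Rlt_le, Rinv_0_lt_compat; lra).
    apply Rmult_le_reg_l with (2 * PI); [lra|].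
    rewrite <- Rmult_assoc, Rinv_r, Rmult_1_l by lra.
    eapply Rle_trans; [exact H|]. lra.
  - intros t _. change (Cmod (F (z + h)%C t - F z t - h * D t) <=
      exp (Cmod z) * (exp 1 * exp 1) * exp 1 * Cmod h ^ 2).
    unfold D, F, psi_integrand.
    set (e := eit (IZR (-1) * t)). set (w := eit (IZR (Z.of_nat p) * t)).
    set (b := (RtoC (- / INR m) * _)%C).
    set (c := (RtoC (- / INR p) * _)%C).
    rewrite Cmult_plus_distr_r, Cexp_plus.
    replace (_ - _ - _)%C with
      (w * (Cexp (z * e) * (Cexp b * Cexp c)) * (Cexp (h * e) - (1 + h * e)))%C by ring.
    assert (He : forall u r, Cmod u <= r -> 0 <= Cmod (Cexp u) <= exp r).
    { intros u r Hu. split; [apply Cmod_ge_0|].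
      eapply Rle_trans; [apply Cmod_Cexp_le|now apply exp_le_compat]. }
    assert (Hz : 0 <= Cmod (Cexp (z * e)) <= exp (Cmod z)).
    { apply He. unfold e. rewrite Cmod_mult, Cmod_eit. lra. }
    assert (Hb : 0 <= Cmod (Cexp b) <= exp 1).
    { apply He. unfold b. rewrite Cmod_mult, Cmod_eit, Rmult_1_r, Cmod_Rinv_opp by exact Hm.
      now apply Rinv_INR_le_1. }
    assert (Hc : 0 <= Cmod (Cexp c) <= exp 1).
    { apply He. unfold c, w. rewrite Cmod_mult, Cmod_eit, Rmult_1_r, Cmod_Rinv_opp by exact Hp.
      now apply Rinv_INR_le_1. }
    assert (Hhe : Cmod (h * e) = Cmod h).
    { unfold e. rewrite Cmod_mult, Cmod_eit. ring. }
    assert (Hr : Cmod (Cexp (h * e) - (1 + h * e)) <= exp 1 * Cmod h ^ 2).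
    { replace (1 + h * e)%C with (exp_sum 1 (h * e)).
      2:{ unfold exp_sum. rewrite Csum_S, Csum_0. simpl. rewrite Rinv_1. ring. }
      eapply Rle_trans; [apply Cexp_exp_sum|]. rewrite Hhe.
      assert (E := exp_le_compat _ _ Hh). assert (P := exp_pos (Cmod h)).
      assert (H0 := Cmod_ge_0 h). assert (Q := pow_le _ 2 H0).
      rewrite Rmult_comm. apply Rmult_le_compat; try lra.
      - apply Rdiv_le_0_compat; [exact Q|apply INR_fact_lt_0].
      - simpl INR. lra. }
    rewrite Cmod_mult, (Rmult_assoc _ (exp 1) (Cmod h ^ 2)).
    apply Rmult_le_compat; try apply Cmod_ge_0; [|exact Hr].
    rewrite !Cmod_mult. unfold w at 1. rewrite Cmod_eit, Rmult_1_l.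
    apply Rmult_le_compat; try tauto.
    + apply Rmult_le_pos; tauto.
    + apply Rmult_le_compat; tauto.
Qed.

(** * Upper and lower estimates of the growth quotient *)

Lemma psi_max_modulus (n k : nat) (s : R) :
  (1 < k)%nat -> (k < n)%nat -> 1 <= s ->
  max_modulus (psi n k) (s ^ k) <= exp (4 * s ^ (k - 1)) /\
  forall z, Cmod z = s ^ k -> Cmod (psi n k z) <= max_modulus (psi n k) (s ^ k).
Proof.
  intros hk hkn Hs. apply max_modulus_le.
  - apply pow_le; lra.
  - intros z Hz. now apply psi_bound.
Qed.

Lemma exists_kth_root (r : R) (k : nat) :
  (0 < k)%nat -> 1 <= r -> exists s, 1 <= s /\ s ^ k = r /\ INR k * ln s = ln r.
Proof.
  intros Hk Hr. assert (HkR : 0 < INR k) by now apply lt_0_INR.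
  assert (Hl : 0 <= ln r) by (rewrite <- ln_1; apply ln_le; lra).
  exists (exp (ln r / INR k)).
  assert (E : INR k * (ln r / INR k) = ln r) by (field; lra).
  repeat split.
  - rewrite <- exp_0. now apply exp_le_compat, Rdiv_le_0_compat.
  - rewrite pow_exp, E. apply exp_ln. lra.
  - now rewrite ln_exp.
Qed.

(** For [r = s^k] the bound [exp (4 s^(k-1))] yields [ln ln M <= ln 4 + (1 - 1/k) ln r], and
    [r > exp (ln 4 / eps)] makes [ln 4] smaller than [eps * ln r]. *)
Lemma psi_order_upper (n k : nat) (eps : R) :
  (1 < k)%nat -> (k < n)%nat -> 0 < eps ->
  exists a, forall r, a < r ->
  ln (ln (max_modulus (psi n k) r)) / ln r <= 1 - 1 / INR k + eps.
Proof.
  intros hk hkn Heps. exists (exp (ln 4 / eps)). intros r Hr.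
  assert (H4 : 0 < ln 4) by (rewrite <- ln_1; apply ln_increasing; lra).
  assert (H1r : 1 < r).
  { eapply Rle_lt_trans; [|exact Hr]. rewrite <- exp_0.
    apply exp_le_compat, Rlt_le. now apply Rdiv_lt_0_compat. }
  assert (Hlr : ln 4 / eps < ln r).
  { rewrite <- (ln_exp (ln 4 / eps)). apply ln_increasing; [apply exp_pos|exact Hr]. }
  assert (Hlr0 : 0 < ln r) by (rewrite <- ln_1; apply ln_increasing; lra).
  destruct (exists_kth_root r k) as (s & Hs & Hsk & Hls); [lia|lra|].
  destruct (psi_max_modulus n k s hk hkn Hs) as [HM _]. rewrite Hsk in HM.
  assert (Hsp : 1 <= s ^ (k - 1)) by now apply pow_R1_Rle.
  assert (L1 : ln (max_modulus (psi n k) r) <= 4 * s ^ (k - 1)).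
  { rewrite <- (ln_exp (4 * s ^ (k - 1))). apply ln_le_of_ge_1; [exact HM|].
    generalize (exp_ineq1_le (4 * s ^ (k - 1))). lra. }
  assert (L2 := ln_le_of_ge_1 _ _ L1 ltac:(lra)).
  rewrite ln_mult, ln_pow in L2 by lra.
  assert (Hk : 0 < INR k) by (apply lt_0_INR; lia).
  rewrite minus_INR in L2 by lia.
  apply Rmult_le_reg_r with (ln r); [exact Hlr0|].
  unfold Rdiv at 1. rewrite Rmult_assoc, Rinv_l, Rmult_1_r by lra.
  eapply Rle_trans; [exact L2|].
  replace (ln s) with (ln r / INR k) by (rewrite <- Hls; field; lra).
  apply Rmult_lt_compat_r with (r := eps) in Hlr; [|exact Heps].
  replace (ln 4 / eps * eps) with (ln 4) in Hlr by (field; lra).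
  replace ((INR k - INR 1) * (ln r / INR k)) with ((1 - 1 / INR k) * ln r)
    by (simpl; field; lra).
  lra.
Qed.

(** Along the radii of [psi_growth], with [L = ln (A + 1)], one has [ln ln M >= L - 1] and
    [ln r = (1 + k (ln p + L)) / p]; the quotient of these tends to [p / k = 1 - 1/k]. *)
Lemma psi_order_lower (n k : nat) (eps a : R) :
  (1 < k)%nat -> (k < n)%nat -> 0 < eps ->
  exists r, a < r /\
  1 - 1 / INR k - eps <= ln (ln (max_modulus (psi n k) r)) / ln r.
Proof.
  intros hk hkn Heps.
  set (p := (k - 1)%nat).
  assert (HkR : INR k = INR p + 1).
  { unfold p. rewrite minus_INR by lia. simpl; ring. }
  assert (HpR : 1 <= INR p) by (apply (le_INR 1); unfold p; lia).
  assert (Hlp : 0 <= ln (INR p)) by (rewrite <- ln_1; apply ln_le; lra).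
  (* After multiplication by [p * ln r] the terms in [L] without [eps] cancel, and what is left to
     absorb is [p/k + p + p ln p], at most [K]. So [K <= eps * L] suffices. *)
  set (K := 2 * INR p + INR p * ln (INR p)).
  destruct (INR_unbounded a) as [A1 HA1].
  destruct (INR_unbounded (exp (K / eps))) as [A2 HA2].
  (* The summand 5 serves [psi_growth], [A1] gives [r > a], and [A2] gives [K <= eps * L]. *)
  set (A := (5 + A1 + A2)%nat).
  assert (HA : INR (S A) = 6 + INR A1 + INR A2).
  { unfold A. rewrite S_INR, !plus_INR. simpl; ring. }
  assert (P1 := pos_INR A1). assert (P2 := pos_INR A2).
  set (L := ln (INR (S A))).
  assert (HL : K / eps <= L).
  { rewrite <- (ln_exp (K / eps)). apply ln_le; [apply exp_pos|lra]. }
  assert (HL0 : 0 <= L) by (unfold L; rewrite <- ln_1; apply ln_le; lra).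
  set (X := INR (p * S A)).
  assert (HX : X = INR p * INR (S A)) by apply mult_INR.
  assert (HXA : INR (S A) <= X) by (rewrite HX; nra).
  assert (HlX : ln X = ln (INR p) + L) by (rewrite HX, ln_mult by lra; reflexivity).
  set (y := (1 + INR k * ln X) / INR p).
  assert (Hy : INR p * y = 1 + INR k * ln X) by (unfold y; field; lra).
  (* As [k = p + 1], the product [p * y] exceeds [p * ln X]. Hence [X < r], which gives both [a < r]
     and [1 <= r]. *)
  assert (HyX : ln X < y).
  { apply Rmult_lt_reg_l with (INR p); [lra|]. rewrite Hy, HkR. nra. }
  set (r := exp y).
  assert (HrX : X < r).
  { unfold r. rewrite <- (exp_ln X) by lra. now apply exp_increasing. }
  assert (Hlr : ln r = y) by apply ln_exp.
  exists r. split; [lra|].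
  destruct (exists_kth_root r k) as (s & Hs & Hsk & _); [lia|lra|].
  destruct (psi_max_modulus n k s hk hkn Hs) as [_ HM]. rewrite Hsk in HM.
  assert (Hrp : r ^ (k - 1) = exp 1 * INR ((k - 1) * S A) ^ k).
  { fold p. fold X. unfold r. rewrite pow_exp, Hy, exp_plus, <- pow_exp, exp_ln by lra.
    reflexivity. }
  assert (HG := psi_growth n k A r _ hk hkn ltac:(unfold A; lia) ltac:(lra) Hrp HM).
  set (M := max_modulus (psi n k) r) in *.
  (* The loss of [ln 2] is weakened to a division by [e], which the next logarithm turns into the
     clean bound [L - 1]. *)
  assert (L1 : INR (S A) / exp 1 <= ln M).
  { assert (HlnG : INR (S A) - ln 2 <= ln M).
    { rewrite <- (ln_exp (INR (S A))), <- ln_div by (try apply exp_pos; lra).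
      apply ln_le; [|exact HG]. apply Rdiv_lt_0_compat; [apply exp_pos|lra]. }
    assert (H2 : ln 2 <= 1).
    { rewrite <- (ln_exp 1). apply ln_le; [lra|]. generalize (exp_ineq1_le 1). lra. }
    assert (He : INR (S A) / exp 1 <= INR (S A) / 2).
    { apply Rmult_le_compat_l; [lra|]. apply Rinv_le_contravar; [lra|].
      generalize (exp_ineq1_le 1). lra. }
    lra. }
  assert (L2 : L - 1 <= ln (ln M)).
  { unfold L. rewrite <- (ln_exp 1), <- ln_div by (try apply exp_pos; lra).
    apply ln_le; [|exact L1]. apply Rdiv_lt_0_compat; [lra|apply exp_pos]. }
  assert (Hy0 : 0 < y) by lra.
  rewrite Hlr. apply Rmult_le_reg_r with y; [exact Hy0|].
  unfold Rdiv at 2. rewrite Rmult_assoc, Rinv_l, Rmult_1_r by lra.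
  eapply Rle_trans; [|exact L2].
  assert (HKL : K <= eps * L).
  { apply Rmult_le_compat_r with (r := eps) in HL; [|lra].
    replace (K / eps * eps) with K in HL by (field; lra). lra. }
  apply Rmult_le_reg_l with (INR p); [lra|].
  replace (INR p * ((1 - 1 / INR k - eps) * y)) with ((1 - 1 / INR k - eps) * (INR p * y)) by ring.
  rewrite Hy, HlX.
  replace (1 - 1 / INR k) with (INR p * / INR k) by (rewrite HkR; field; lra).
  replace ((INR p * / INR k - eps) * (1 + INR k * (ln (INR p) + L)))
    with (INR p * / INR k + INR p * (ln (INR p) + L) - eps * (1 + INR k * (ln (INR p) + L)))
    by (field; lra).
  assert (Hik : INR p * / INR k <= INR p).
  { rewrite <- (Rmult_1_r (INR p)) at 2. apply Rmult_le_compat_l; [lra|].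
    apply Rinv_INR_le_1. lia. }
  assert (HeL : eps * L <= eps * (1 + INR k * (ln (INR p) + L))).
  { apply Rmult_le_compat_l; [lra|]. rewrite HkR. nra. }
  unfold K in HKL. lra.
Qed.

Theorem theorem7 (n k : nat) (hk : (1 < k)%nat) (hkn : (k < n)%nat) :
  entire (psi n k) /\ order (psi n k) = Finite (1 - 1 / INR k).
Proof.
  split; [now apply psi_entire|]. apply LimSup_pinfty_eq.
  - intros eps Heps. now apply psi_order_upper.
  - intros eps a Heps. now apply psi_order_lower.
Qed.
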